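(* Let $a>0$ be a real number and let $F$ be a finite set of positive integers. The following conditions are equivalent. 1. The measure $\displaystyle\rho_a^F=\sum_{x=u_F}^\infty\ \prod_{f\in F}(x-f-u_F)\,\frac{a^{x-u_F}}{(x-u_F)!}\,\delta_x$ is positive. 2. The finite set $F$ is admissible. 3. $\Omega_F^a(n)\,\Omega_F^a(n+1)>0$ for all nonnegative integers $n$.
   Context: Charlier polynomials ($a\ne0$): $c_n^a(x)=\frac1{n!}\sum_{j=0}^n(-a)^{n-j}\binom nj\binom xj j!$, $n\ge0$. For $F=\{f_1<\cdots<f_k\}$, $u_F=\sum_{f\in F}f-\binom{k+1}{2}$ and $\Omega_F^a(x)=\det\big(c_{f_i}^a(x+j-1)\big)_{i,j=1}^k$. Admissible: write $F=\bigcup_{i=1}^KY_i$ as a disjoint union where the elements of each $Y_i$ are consecutive integers and $1+\max Y_i<\min Y_{i+1}$ for $i=1,\dots,K-1$. $F$ is admissible if every $Y_i$ has an even number of elements. A discrete measure is called positive if all its point masses are nonnegative (and it is not zero). *)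

(* Defs.v *)
From HB Require Import structures.
From mathcomp Require Import all_boot all_order all_algebra finmap.
From mathcomp Require Import all_classical all_reals all_analysis.

Set Implicit Arguments.
Unset Strict Implicit.
Unset Printing Implicit Defensive.

Import Order.TTheory GRing.Theory Num.Theory.
Import numFieldNormedType.Exports.

Local Open Scope ring_scope.

Section discrete_charge.
Local Open Scope classical_set_scope.
Local Open Scope ereal_scope.
Context d (T : measurableType d) (R : realType).
Variables (w : nat -> R) (p : nat -> T) (m : nat).

(* The signed measure that puts the mass w n at the point p n, for n >= m. *)
Definition discrete (A : set T) : \bar R :=
  \sum_(m <= n <oo) (w n)%:E * \d_(p n) A.

Hypothesis sw : summable (fun n => m <= n)%N (EFin \o w).

Let wpos n : (0 <= Num.max (w n) 0)%R. Proof. by rewrite le_max lexx orbT. Qed.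
Let wneg n : (0 <= Num.max (- w n) 0)%R.
Proof. by rewrite le_max lexx orbT. Qed.

Let mpos : {measure set T -> \bar R} :=
  mseries (fun n => mscale (NngNum (wpos n)) (\d_(p n))) m.
Let mneg : {measure set T -> \bar R} :=
  mseries (fun n => mscale (NngNum (wneg n)) (\d_(p n))) m.

Let sterm A : summable (fun n => m <= n)%N (fun n => (w n)%:E * \d_(p n) A).
Proof.
apply: le_lt_trans sw; apply: le_esum => n _; rewrite /dirac indicE.
by case: (_ \in _); rewrite -EFinM /= ?mulr1// mulr0 normr0 lee_fin.
Qed.

Let mposE A : mpos A =
  \sum_(i <oo | (m <= i)%N) (fun n => (w n)%:E * \d_(p n) A)^\+ i.
Proof.
rewrite -ereal_series; apply: eq_eseriesr => n _.
rewrite funeposE /= /mscale /= /dirac indicE.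
by case: (_ \in _); rewrite -?EFinM /= ?mulr1 ?EFin_max// ?mulr0 maxxx.
Qed.

Let mnegE A : mneg A =
  \sum_(i <oo | (m <= i)%N) (fun n => (w n)%:E * \d_(p n) A)^\- i.
Proof.
rewrite -ereal_series; apply: eq_eseriesr => n _.
rewrite funenegE /= /mscale /= /dirac indicE.
by case: (_ \in _); rewrite -?EFinM /= ?mulr1 ?EFin_max// ?mulr0 ?oppr0 maxxx.
Qed.

Let discreteE A : discrete A = mpos A - mneg A.
Proof. by rewrite /discrete ereal_series summable_eseries// mposE mnegE. Qed.

Let mpos_fin A : mpos A \is a fin_num.
Proof.
rewrite ge0_fin_numE// mposE nneseries_esum//.
have := summable_funepos (sterm A); apply: le_lt_trans.
by apply: le_esum => n _; rewrite gee0_abs.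
Qed.

Let mneg_fin A : mneg A \is a fin_num.
Proof.
rewrite ge0_fin_numE// mnegE nneseries_esum//.
have := summable_funeneg (sterm A); apply: le_lt_trans.
by apply: le_esum => n _; rewrite gee0_abs.
Qed.

Lemma discrete0 : discrete set0 = 0.
Proof. by rewrite discreteE !measure0 sube0. Qed.

Lemma discrete_fin_num A : measurable A -> discrete A \is a fin_num.
Proof. by move=> _; rewrite discreteE fin_numB mpos_fin mneg_fin. Qed.

Lemma discrete_sigma_additive : semi_sigma_additive discrete.
Proof.
move=> A mA tA mUA; rewrite discreteE.
rewrite [X in X @ \oo --> _](_ : _ = (fun n => \sum_(0 <= i < n) mpos (A i)) \-
    (fun n => \sum_(0 <= i < n) mneg (A i))); last first.
  apply/funext => n /=; under eq_bigr do rewrite discreteE.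
  rewrite big_split/= sumeN// => i j _ _.
  by apply: fin_num_adde_defl; exact: mneg_fin.
apply: cvgeB; last 2 first.
- exact: measure_semi_sigma_additive.
- exact: measure_semi_sigma_additive.
by rewrite fin_num_adde_defr.
Qed.

End discrete_charge.

Local Open Scope fset_scope.

(* The elements f_1 < ... < f_k of F in increasing order. *)
Definition elems (F : {fset nat}) : seq nat := sort leq F.

(* fmin and fmax have the junk value 0 on the empty set. *)
Definition fmin (F : {fset nat}) : nat := head 0%N (elems F).

Definition fmax (F : {fset nat}) : nat := last 0%N (elems F).

Definition consecutive (Y : {fset nat}) : Prop :=
  Y != fset0 /\ elems Y = iota (fmin Y) #|` Y|.

Definition block_decomposition (F : {fset nat}) (Ys : seq {fset nat}) : Prop :=
  [/\ F = \bigcup_(Y <- Ys) Y,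
      pairwise (fun Y Z : {fset nat} => [disjoint Y & Z]) Ys,
      {in Ys, forall Y, consecutive Y} &
      sorted (fun Y Z => 1 + fmax Y < fmin Z)%N Ys].

Definition admissible (F : {fset nat}) : Prop :=
  exists2 Ys : seq {fset nat}, block_decomposition F Ys &
    {in Ys, forall Y : {fset nat}, ~~ odd #|` Y|}.

(* The truncated subtraction is exact on sets of positive integers: see
   bin_le_sum. *)
Definition uF (F : {fset nat}) : nat :=
  (\sum_(f <- F) f - 'C(#|` F|.+1, 2))%N.

Lemma bin_le_sum (F : {fset nat}) : (forall f, f \in F -> (0 < f)%N) ->
  ('C(#|` F|.+1, 2) <= \sum_(f <- F) f)%N.
Proof.
move=> F0.
have -> : (\sum_(f <- F) f = \sum_(f <- elems F) f)%N.
  by apply: perm_big; rewrite perm_sym perm_sort.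
have sE : size (elems F) = #|` F| by rewrite size_sort.
have sF : sorted ltn (elems F).
  by rewrite ltn_sorted_uniq_leq sort_uniq fset_uniq (sort_sorted leq_total).
have {}F0 : all (leq 1) (elems F).
  by apply/allP => f; rewrite mem_sort => /F0.
rewrite -sE (big_nth 0%N) -triangular_sum big_mkord.
rewrite big_ord_recl/= add0n big_mkord.
apply: leq_sum => i _; rewrite /bump/= add1n.
move: (elems F) sF F0 i => s + + [i /=].
elim: i => [|i IH] ss s1 iS; first exact/(all_nthP _ s1).
apply: leq_ltn_trans (IH ss s1 (ltnW iS)) _.
exact: (sortedP 0%N ss).
Qed.

Section charlier.
Variable R : realType.
Implicit Types (a : R) (F : {fset nat}).

(* The polynomial binom(x, j) = x (x - 1) ... (x - j + 1) / j!. *)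
Definition binom_poly (j : nat) : {poly R} :=
  (j`!%:R)^-1 *: \prod_(i < j) ('X - i%:R%:P).

Definition charlier a (n : nat) : {poly R} :=
  (n`!%:R)^-1 *:
    \sum_(j < n.+1) ((- a) ^+ (n - j) * 'C(n, j)%:R * j`!%:R) *: binom_poly j.

(* Indices start at 0, hence x + j instead of x + j - 1. *)
Definition Omega a F (x : R) : R :=
  \det (\matrix_(i < #|` F|, j < #|` F|)
          (charlier a (nth 0%N (elems F) i)).[x + j%:R]).

(* The point mass at the integer x; only used for uF F <= x. *)
Definition rho_mass a F (x : nat) : R :=
  \prod_(f <- F) (x%:R - f%:R - (uF F)%:R) *
  (a ^+ (x - uF F) / (x - uF F)`!%:R).

Definition rho a F : set (measurableTypeR R) -> \bar R :=
  discrete (rho_mass a F) (fun x => x%:R : measurableTypeR R) (uF F).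

Lemma rho_mass_le a F n :
  `|rho_mass a F (n + uF F)| <=
  (2 ^ \sum_(f <- F) f)%:R * exp_coeff (`|a| * 2 ^+ #|` F|) n.
Proof.
rewrite /rho_mass addnK /exp_coeff/= !normrM normr_prod normrX.
rewrite (ger0_norm (_ : 0 <= (n`!%:R)^-1)) ?invr_ge0// mulrA [leRHS]mulrA.
rewrite ler_pM2r ?invr_gt0 ?ltr0n ?fact_gt0// exprMn mulrCA [leLHS]mulrC.
rewrite ler_wpM2l ?exprn_ge0// -exprM natrX.
rewrite (_ : _ * _ = \prod_(f <- F) (2 ^+ f * 2 ^+ n)); last first.
  by rewrite big_split/= prodrXr big_const_seq count_predT iter_mulr_1 -exprM mulnC.
apply: ler_prod => f _; rewrite normr_ge0/= natrD [X in `|X|]addrAC addrK.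
apply: (le_trans (ler_normB _ _)); rewrite !normr_nat -exprD -natrD -natrX.
by rewrite ler_nat addnC ltnW// ltn_expl.
Qed.

Lemma summable_rho_mass a F :
  summable (fun x => uF F <= x)%N (EFin \o rho_mass a F).
Proof.
rewrite /summable -nneseries_esum// -ereal_series -nneseries_addn//=.
set g := fun n => (2 ^ \sum_(f <- F) f)%:R * exp_coeff (`|a| * 2 ^+ #|` F|) n.
have cg : cvgn (series g) by exact/is_cvg_seriesZ/is_cvg_series_exp_coeff.
apply: (@le_lt_trans _ _ (\sum_(n <oo) (g n)%:E)%E).
  by apply: lee_nneseries => n *; rewrite ?lee_fin// rho_mass_le.
rewrite (_ : limn _ = (limn (series g))%:E) ?ltry// -EFin_lim//.
by apply/congr_lim/funext => n /=; rewrite sumEFin.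
Qed.

HB.instance Definition _ a F := isCharge.Build _ _ _ (rho a F)
  (discrete0 _ (summable_rho_mass a F))
  (@discrete_fin_num _ _ _ _ _ _ (summable_rho_mass a F))
  (discrete_sigma_additive (summable_rho_mass a F)).

End charlier.

Definition positive_charge (R : realType)
    (mu : {charge set (measurableTypeR R) -> \bar R}) : Prop :=
  (forall x : R, (0 <= mu [set x]%classic)%E) /\
  exists2 A : set (measurableTypeR R), measurable A & mu A <> 0%E.

(* Main.v *)
(* With P_n the Charlier polynomial normalized by P_n(0) = 1, duality gives
   c_f^a(n) = (-a)^f / f! P_n(f), so that Omega_F^a(n) is a constant times
   D_n = det (P_{n+j}(f_i)). Let L be the Charlier (Poisson) functional and
   M = prod_{f in F} (X - f). By Christoffel's formula, bordering D_n with a row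
   P_{n+j}(x) gives M q_n, where (q_n) is orthogonal for the functional
   p |-> L (M p) and L (M q_n^2) is a positive multiple of D_n D_{n+1}. Hence all
   the products D_n D_{n+1} are positive if and only if L (M p^2) >= 0 for all
   p; testing on polynomials that concentrate at one integer shows that this
   means M >= 0 on the natural numbers. The sign of M at n is read off the parity
   of the number of elements of F above n, which links it to admissibility. *)

From HB Require Import structures.
Require Import Defs.
From mathcomp Require Import all_boot all_order all_algebra finmap.
From mathcomp Require Import all_classical all_reals all_analysis.
From mathcomp Require Import ring lra zify.
Import Order.TTheory GRing.Theory Num.Theory.
Import numFieldNormedType.Exports.
Local Open Scope ring_scope.
Local Open Scope classical_set_scope.

(** * The Poisson functional and Charlier orthogonality *)

Section poisson_functional.
Variables (R : realType) (a : R).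
Hypothesis a_gt0 : 0 < a.
Implicit Types p q : {poly R}.

Let a_neq0 : a != 0. Proof. by rewrite gt_eqF. Qed.

Definition poisson_term p : R^nat := fun x => p.[x%:R] * exp_coeff a x.

Definition poisson p : R := limn (series (poisson_term p)).

(** The term at 0 vanishes and [x / x! = 1 / (x - 1)!], so the index shifts by one. *)
Lemma series_poisson_termMX p n :
  series (poisson_term (p * 'X)) n.+1 =
  a * series (poisson_term (p \Po ('X + 1))) n.
Proof.
rewrite /series/= big_nat_recl//= {1}/poisson_term hornerMX mulr0 mul0r add0r.
rewrite big_distrr/=; apply: eq_bigr => x _.
rewrite /poisson_term hornerMX horner_comp hornerD hornerX hornerC /exp_coeff/=.
rewrite natr1 factS natrM exprS invfM.
have x0 : x.+1%:R != 0 :> R by rewrite pnatr_eq0.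
by field; rewrite nat1r x0 pnatr_eq0 -lt0n fact_gt0.
Qed.

(** Induction on the degree: the constant term gives the exponential series, and the index shift
    trades [p * 'X] for [p \Po ('X + 1)], of smaller degree. *)
Lemma is_cvg_poisson p : cvgn (series (poisson_term p)).
Proof.
have [n] := ubnP (size p); elim: n p => // n IH.
elim/poly_ind => [_|p c _ sp].
  rewrite (_ : poisson_term 0 = 0); last first.
    by apply/funext => x; rewrite /poisson_term horner0 mul0r.
  rewrite (_ : series 0 = 0); first exact: is_cvg_cst.
  by apply/funext => x; rewrite /series/= big1.
have -> : series (poisson_term (p * 'X + c%:P)) =
    series (poisson_term (p * 'X)) + series (c *: exp_coeff a).
  apply/funext => x; rewrite fctE /series/= -big_split/=; apply: eq_bigr => i _.
  by rewrite /poisson_term hornerD hornerC mulrDl.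
apply: is_cvgD; last exact/is_cvg_seriesZ/is_cvg_series_exp_coeff.
have [->|p0] := eqVneq p 0.
  rewrite (_ : series _ = 0); first exact: is_cvg_cst.
  apply/funext => x; rewrite /series/= big1// => i _.
  by rewrite /poisson_term mul0r horner0 mul0r.
have /IH/cvg_ex[/= l hl] : (size (p \Po ('X + 1)) < n)%N.
  rewrite size_comp_poly2; last by rewrite size_XaddC.
  by move: sp; rewrite size_MXaddC (negPf p0)/=.
apply/cvg_ex; exists (a * l); rewrite -cvg_shiftS.
rewrite (_ : [sequence _]_n =
  fun n => a * series (poisson_term (p \Po ('X + 1))) n).
  exact: cvgMl_tmp.
by apply/funext => i /=; rewrite series_poisson_termMX.
Qed.

Lemma poissonMX p : poisson (p * 'X) = a * poisson (p \Po ('X + 1)).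
Proof.
suff H : series (poisson_term (p * 'X)) @ \oo --> a * poisson (p \Po ('X + 1)).
  exact: cvg_lim H.
rewrite -cvg_shiftS (_ : [sequence _]_n =
  fun n => a * series (poisson_term (p \Po ('X + 1))) n).
  by apply: cvgMl_tmp; exact: is_cvg_poisson.
by apply/funext => i /=; rewrite series_poisson_termMX.
Qed.

Lemma poisson_is_linear : linear_for *%R poisson.
Proof.
move=> c p q.
suff H : series (poisson_term (c *: p + q)) @ \oo --> c * poisson p + poisson q.
  exact: cvg_lim H.
rewrite (_ : series _ = (fun n => c * series (poisson_term p) n) \+
    series (poisson_term q)).
  by apply: cvgD; [apply: cvgMl_tmp|]; exact: is_cvg_poisson.
apply/funext => n /=; rewrite /series/= big_distrr -big_split/=.
by apply: eq_bigr => i _; rewrite /poisson_term hornerD hornerZ mulrDl mulrA.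
Qed.

HB.instance Definition _ :=
  GRing.isLinear.Build R {poly R} R *%R poisson poisson_is_linear.

(** A nonzero polynomial cannot vanish at all naturals, so some term is positive, and the others are
    nonnegative. *)
Lemma poisson_gt0 p : p != 0 -> (forall n : nat, 0 <= p.[n%:R]) -> 0 < poisson p.
Proof.
move=> p_neq0 p_ge0.
have [m pm] : exists m : nat, p.[m%:R] != 0.
  apply/not_existsP => p0; move: (p_neq0).
  have rp : all (root p) [seq i%:R | i <- iota 0 (size p)].
    by apply/allP => _ /mapP[i _ ->]; apply/negPn/negP/p0.
  move=> /max_poly_roots/(_ rp); rewrite size_map size_iota ltnn.
  rewrite map_inj_uniq ?iota_uniq => [/(_ isT)|i j /eqP]//.
  by rewrite eqr_nat => /eqP.
have t_ge0 n : 0 <= poisson_term p n by rewrite mulr_ge0// exp_coeff_ge0// ltW.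
apply: (@lt_le_trans _ _ (series (poisson_term p) m.+1)).
  rewrite seriesS ltr_pwDl//; last by apply: sumr_ge0.
  rewrite mulr_gt0//; first by rewrite lt_neqAle p_ge0 andbT eq_sym.
  by rewrite divr_gt0 ?exprn_gt0// ltr0n fact_gt0.
apply: nondecreasing_cvgn_le; last exact: is_cvg_poisson.
by apply/nondecreasing_series => i _.
Qed.

Lemma coef_top_comp_XaddC p c n :
  (size p <= n.+1)%N -> (p \Po ('X + c%:P))`_n = p`_n.
Proof.
rewrite leq_eqVlt => /orP[/eqP sp|sp]; last first.
  by rewrite !nth_default// size_comp_poly2 ?size_XaddC.
have := @lead_coef_comp _ p ('X + c%:P); rewrite size_XaddC => /(_ isT).
by rewrite lead_coefXaddC expr1n mulr1 !lead_coefE size_comp_poly2 ?size_XaddC// sp.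
Qed.

Definition diffp p := p \Po ('X + 1) - p.

Lemma coef_diffp p n : (size p <= n.+2)%N -> (diffp p)`_n = n.+1%:R * p`_n.+1.
Proof.
elim/poly_ind: p n => [|p c IH] n.
  by rewrite /diffp comp_poly0 subrr !coef0 mulr0.
move=> sp; have {}sp : (size p <= n.+1)%N.
  by move: sp; rewrite size_MXaddC; case: ifP => // /andP[/eqP-> _]; rewrite size_poly0.
have -> : diffp (p * 'X + c%:P) = diffp p * 'X + (p \Po ('X + 1)).
  by rewrite /diffp comp_polyD comp_polyM comp_polyX comp_polyC; ring.
rewrite coefD coefMX coef_top_comp_XaddC// [in RHS]coefD [in RHS]coefMX coefC/= addr0.
case: n sp => [|n] sp/=; first by rewrite add0r mul1r.
by rewrite IH// -[in RHS]natr1 mulrDl mul1r.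
Qed.

Lemma size_diffp p n : (size p <= n.+1)%N -> (size (diffp p) <= n)%N.
Proof.
move=> sp; apply/leq_sizeP => j nj.
have := coef_top_comp_XaddC p 1 j (leq_trans sp (nj : n.+1 <= j.+1)%N).
by rewrite coefB => ->; rewrite subrr.
Qed.

(* The Charlier polynomial of degree n, normalized to be 1 at 0. *)
Fixpoint charlier_op n : {poly R} :=
  if n is m.+1 then
    charlier_op m - a^-1 *: ((charlier_op m \Po ('X - 1)) * 'X) else 1.

Lemma charlier_op_top n :
  (size (charlier_op n) <= n.+1)%N /\ (charlier_op n)`_n = (- a) ^- n.
Proof.
elim: n => [|n [sn IH]] /=; first by rewrite size_poly1 coefC expr0 invr1.
have sc : (size (charlier_op n \Po ('X - 1)) <= n.+1)%N.
  by rewrite size_comp_poly2 ?size_XsubC.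
split.
  rewrite (leq_trans (size_polyD _ _))// geq_max (leq_trans sn)//= size_polyN.
  rewrite (leq_trans (size_scale_leq _ _))// (leq_trans (size_polyMleq _ _))//.
  by rewrite size_polyX addn2.
rewrite coefB nth_default// coefZ coefMX/= -polyCN coef_top_comp_XaddC//.
by rewrite IH exprS invfM invrN sub0r mulNr.
Qed.

Definition size_charlier_op n := (charlier_op_top n).1.
Definition coef_charlier_op n := (charlier_op_top n).2.

(** Summation by parts: under the functional, the operator that produces [charlier_op n.+1] from
    [charlier_op n] is adjoint to minus the forward difference. *)
Lemma charlier_opS n p :
  poisson (charlier_op n.+1 * p) = - poisson (charlier_op n * diffp p).
Proof.
rewrite /= mulrBl raddfB/= -scalerAl linearZ/= mulrAC poissonMX.
rewrite mulrA mulVf// mul1r comp_polyM -comp_polyA.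
rewrite (_ : ('X - 1) \Po ('X + 1) = 'X); last first.
  by rewrite comp_polyB comp_polyX comp_polyC addrK.
by rewrite comp_polyXr /diffp mulrBr raddfB/= opprB.
Qed.

(** Moving all [n] operators across leaves the [n]-th difference of [p], which is the constant [n!]
    times its coefficient of degree [n]. *)
Lemma charlier_op_ortho n p : (size p <= n.+1)%N ->
  poisson (charlier_op n * p) = (-1) ^+ n * n`!%:R * p`_n * poisson 1.
Proof.
elim: n p => [|n IH] p sp.
  rewrite [in LHS](size1_polyC sp) -[(p`_0)%:P]mulr1 mul_polyC /= mul1r linearZ/=.
  by rewrite expr0 fact0 !mul1r.
rewrite charlier_opS IH ?size_diffp// coef_diffp// exprS factS natrM.
by ring.
Qed.

End poisson_functional.

(** * Christoffel's formula and the modified functional *)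

Section christoffel.
Variables (R : realType) (a : R).
Hypothesis a_gt0 : 0 < a.
Variable s : seq R.
Hypothesis uniq_s : uniq s.
Implicit Types p q : {poly R}.

Local Notation k := (size s).
Local Notation L := (poisson R a).
Local Notation P := (charlier_op R a).

Definition nodal : {poly R} := \prod_(z <- s) ('X - z%:P).

Local Notation M := (nodal).

Let monic_M : M \is monic. Proof. exact: monic_prod_XsubC. Qed.

Let size_M : size M = k.+1. Proof. exact: size_prod_XsubC. Qed.

Let L1_gt0 : 0 < L 1.
Proof. by apply: poisson_gt0 => // [|n]; rewrite ?oner_neq0// hornerC. Qed.

Definition casorati_mx n :=
  \matrix_(i < size s, j < size s) (charlier_op R a (n + j)).[s`_i].

Definition casorati n := \det (casorati_mx n).

Local Notation D := (casorati).

(** The index [size s] is out of range, so the default value of [nth] puts [x] in the last row. *)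
Definition bordered_mx n (x : R) :=
  \matrix_(i < (size s).+1, j < (size s).+1) (charlier_op R a (n + j)).[nth x s i].

(** The bordered determinant expanded along its last row, as a polynomial in the border point. The
    cofactors omit that row, so the argument 0 is arbitrary. *)
Definition christoffel_num n : {poly R} :=
  \sum_(j < (size s).+1) cofactor (bordered_mx n 0) ord_max j *: charlier_op R a (n + j).

Local Notation Q := (christoffel_num).

Lemma horner_christoffel_num n x : (Q n).[x] = \det (bordered_mx n x).
Proof.
rewrite (expand_det_row _ ord_max) horner_sum; apply: eq_bigr => j _.
rewrite hornerZ mulrC mxE nth_default//; congr (_ * _).
rewrite /cofactor; congr (_ * \det _); apply/matrixP => i l; rewrite !mxE.
by rewrite lift_max; congr (_.[_]); exact: set_nth_default.
Qed.

Lemma size_christoffel_num n : (size (Q n) <= (n + k).+1)%N.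
Proof.
apply: (leq_trans (size_sum _ _ _)); apply/bigmax_leqP => j _.
rewrite (leq_trans (size_scale_leq _ _))// (leq_trans (size_charlier_op _ _ _))//.
by rewrite ltnS leq_add2l -ltnS.
Qed.

(** Only the last column reaches degree [n + k]; its cofactor is [D n]. *)
Lemma coef_christoffel_num n : (Q n)`_(n + k) = D n * (- a) ^- (n + k).
Proof.
rewrite coef_sum big_ord_recr/= big1 ?add0r => [|j _]; last first.
  by rewrite coefZ nth_default ?mulr0// (leq_trans (size_charlier_op _ _ _))// ltn_add2l.
rewrite coefZ coef_charlier_op /cofactor addnn -signr_odd odd_double expr0 mul1r.
congr (\det _ * _); apply/matrixP => i l; rewrite !mxE !lift_max.
by congr (_.[_]); exact: set_nth_default.
Qed.

(** Against degree at most [n] only column 0 survives; deleting it shifts the other columns by one,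
    whence [D n.+1]. *)
Lemma christoffel_num_ortho n p : (size p <= n.+1)%N ->
  L (Q n * p) = (-1) ^+ (n + k) * n`!%:R * L 1 * D n.+1 * p`_n.
Proof.
move=> sp; rewrite /christoffel_num mulr_suml raddf_sum/= big_ord_recl/= big1 ?addr0.
  rewrite addn0 -scalerAl linearZ/= charlier_op_ortho// /cofactor/= addn0.
  rewrite (_ : \det _ = D n.+1); first by rewrite exprD; ring.
  congr (\det _); apply/matrixP => i l; rewrite !mxE lift_max lift0 addnS addSn.
  by congr (_.[_]); exact: set_nth_default.
move=> j _; rewrite -scalerAl linearZ/= charlier_op_ortho//.
  rewrite [p`__]nth_default ?mulr0 ?mul0r ?mulr0//.
  by rewrite (leq_trans sp)// /bump/= add1n addnS ltnS leq_addr.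
by rewrite (leq_trans sp)// ltnS leq_addr.
Qed.

Lemma root_nodal_dvd p : all (root p) s -> exists q, p = q * M.
Proof. by move=> ps; apply: uniq_roots_prod_XsubC => //; rewrite uniq_rootsE. Qed.

Lemma size_mul_nodal q (n : nat) : (size (q * M)%R <= n + k)%N = (size q <= n)%N.
Proof.
have [->|q0] := eqVneq q 0; first by rewrite mul0r size_poly0 !leq0n.
by rewrite size_Mmonic// size_M addnS/= leq_add2r.
Qed.

Lemma coef_mul_nodal q (n : nat) : (size q <= n.+1)%N -> (q * M)`_(n + k) = q`_n.
Proof.
rewrite leq_eqVlt => /orP[/eqP sq|sq]; last first.
  by rewrite !nth_default// size_mul_nodal.
have := lead_coef_Mmonic q monic_M.
rewrite !lead_coefE size_Mmonic// -?size_poly_eq0 ?sq// size_M addnS/=.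
by [].
Qed.

Lemma christoffel_numP n : exists q, [/\ Q n = q * M, (size q <= n.+1)%N &
  q`_n = D n * (- a) ^- (n + k)].
Proof.
have [|q qE] := @root_nodal_dvd (Q n).
  apply/(all_nthP 0) => i ik; rewrite /root horner_christoffel_num.
  pose i' := Ordinal (ltnW ik : (i < (size s).+1)%N).
  (* At a node the border repeats an earlier row. *)
  apply/eqP/(determinant_alternate (i1 := i') (i2 := ord_max)).
    by rewrite -val_eqE/= ltn_eqF.
  move=> j; rewrite !mxE/= [in RHS]nth_default//.
  by congr (_.[_]); exact: set_nth_default.
have sq : (size q <= n.+1)%N.
  by rewrite -size_mul_nodal -qE size_christoffel_num.
by exists q; split => //; rewrite -coef_mul_nodal// -qE coef_christoffel_num.
Qed.

(** With one factor [q * M] read as [Q n], orthogonality extracts the coefficient of degree [n] of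
    the other [q]; the two signs of exponent [n + k] cancel. *)
Lemma christoffel_norm n q : Q n = q * M -> (size q <= n.+1)%N ->
  q`_n = D n * (- a) ^- (n + k) ->
  L (q * q * M) = n`!%:R * L 1 * a ^- (n + k) * (D n * D n.+1).
Proof.
move=> qE sq qn; rewrite mulrAC -qE christoffel_num_ortho// qn.
rewrite [(- a) ^+ _]exprNn invfM invr_sign.
rewrite [LHS](_ : _ = (-1) ^+ (n + k) * (-1) ^+ (n + k) *
    (n`!%:R * L 1 * a ^- (n + k) * (D n * D n.+1))); last by ring.
by rewrite -exprMn mulrNN mulr1 expr1n mul1r.
Qed.

Lemma casorati_gt0 : (forall n : nat, 0 <= M.[n%:R]) -> forall n, 0 < D n * D n.+1.
Proof.
move=> M0.
have Lgt0 q : q != 0 -> 0 < L (q * q * M).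
  move=> q0; apply: poisson_gt0 => // [|n].
    by rewrite !mulf_neq0// monic_neq0.
  by rewrite !hornerM mulr_ge0// -expr2 sqr_ge0.
(* A kernel vector would give a combination [T] of [P n], ..., [P (n + k - 1)] vanishing at every
   node. Then [T = q * M] with [q] of degree below [n], and orthogonality gives [L (q * q * M) = 0],
   against positivity. *)
have D_neq0 n : D n != 0.
  apply/negP; rewrite /casorati -det_tr => /det0P[v v0 vA].
  pose T := \sum_(j < k) v 0 j *: P (n + j).
  have [|q qE] := @root_nodal_dvd T.
    apply/(all_nthP 0) => i ik; rewrite /root /T horner_sum.
    have /matrixP/(_ 0 (Ordinal ik)) := vA; rewrite !mxE => vi.
    by rewrite -[X in _ == X]vi; apply/eqP/eq_bigr => j _; rewrite hornerZ !mxE.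
  have sT : (size T <= n + k)%N.
    apply: (leq_trans (size_sum _ _ _)); apply/bigmax_leqP => j _.
    rewrite (leq_trans (size_scale_leq _ _))// (leq_trans (size_charlier_op _ _ _))//.
    by rewrite ltn_add2l.
  have sq : (size q <= n)%N by rewrite -size_mul_nodal -qE.
  have q_neq0 : q != 0.
    apply: contraNneq v0 => q0; move: qE; rewrite q0 mul0r => T0.
    apply/eqP/rowP => j; rewrite mxE.
    (* Since [P (n + j)] has exact degree [n + j], the coefficients vanish one by one from the
       highest index down. *)
    have [m] := ubnP (k - j); elim: m j => // m IH j jm.
    have := congr1 (fun p : {poly R} => p`_(n + j)) T0.
    rewrite coef0 coef_sum (bigD1 j)//= big1 ?addr0 => [|l lj].
      rewrite coefZ coef_charlier_op => /eqP; rewrite mulf_eq0 => /orP[/eqP//|].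
      by rewrite invr_eq0 expf_eq0 oppr_eq0 gt_eqF// andbF.
    have [lt_lj|lt_jl|/val_inj e] := ltngtP l j; last by rewrite e eqxx in lj.
      rewrite coefZ nth_default ?mulr0// (leq_trans (size_charlier_op _ _ _))//.
      by rewrite ltn_add2l.
    by rewrite IH ?scale0r ?coef0//; have := ltn_ord l; lia.
  have := Lgt0 q q_neq0; rewrite mulrAC -qE /T mulr_suml raddf_sum/= big1 ?ltxx// => j _.
  rewrite -scalerAl linearZ/= charlier_op_ortho//.
    by rewrite [q`__]nth_default ?mulr0 ?mul0r ?mulr0// (leq_trans sq)// leq_addr.
  by rewrite (leq_trans sq)// leqW// leq_addr.
move=> n; have [q [qE sq qn]] := christoffel_numP n.
have e := christoffel_norm n q qE sq qn.
have q_neq0 : q != 0.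
  apply/eqP => q0; move: qn; rewrite q0 coef0 => /esym/eqP.
  by rewrite mulf_eq0 (negPf (D_neq0 n)) invr_eq0 expf_eq0 oppr_eq0 gt_eqF// andbF.
have := Lgt0 q q_neq0; rewrite e pmulr_rgt0// mulr_gt0 ?invr_gt0 ?exprn_gt0//.
by rewrite mulr_gt0// ltr0n fact_gt0.
Qed.

(** Gram-Schmidt: subtracting a multiple of the orthogonal polynomial [q] lowers the degree of [p];
    the cross term vanishes and the square of [q] contributes a nonnegative amount. *)
Lemma poisson_nodal_ge0 p : (forall n, 0 < D n * D n.+1) -> 0 <= L (p * p * M).
Proof.
move=> DD; have [n] := ubnP (size p); elim: n p => // -[_ p|n IH p sp].
  by rewrite ltnS leqn0 size_poly_eq0 => /eqP->; rewrite !mul0r raddf0.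
have [q [qE sq qn]] := christoffel_numP n.
have Ln := christoffel_norm n q qE sq qn.
have Lq : 0 <= L (q * q * M).
  rewrite Ln mulr_ge0//; last exact: ltW.
  by rewrite mulr_ge0 ?invr_ge0 ?exprn_ge0 ?mulr_ge0// ltW.
have qn0 : q`_n != 0.
  rewrite qn mulf_neq0//; last by rewrite invr_neq0// expf_neq0// oppr_eq0 gt_eqF.
  by apply: contraTneq (DD n) => ->; rewrite mul0r ltxx.
pose c := p`_n / q`_n; pose r := p - c *: q.
have rn : r`_n = 0 by rewrite coefB coefZ divfK// subrr.
have sr : (size r <= n.+1)%N.
  rewrite (leq_trans (size_polyD _ _))// geq_max -ltnS sp size_polyN.
  exact: leq_trans (size_scale_leq _ _) _.
have Lqr : L (Q n * r) = 0 by rewrite christoffel_num_ortho// rn mulr0.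
have {}sr : (size r < n.+1)%N.
  rewrite ltnS; apply/leq_sizeP => j; rewrite leq_eqVlt => /orP[/eqP<-//|nj].
  by rewrite nth_default// (leq_trans sr).
have -> : p * p * M = c ^+ 2 *: (q * q * M) + (c *+ 2) *: (Q n * r) + r * r * M.
  have -> : p = c *: q + r by rewrite /r addrC subrK.
  by rewrite qE -!mul_polyC; ring.
rewrite !linearD/= !linearZ/= Lqr mulr0 addr0 addr_ge0 ?IH//.
by rewrite mulr_ge0// sqr_ge0.
Qed.

End christoffel.

(** * Values of the binomial polynomials *)

Section binomial_polynomials.
Variable R : realType.

Lemma horner_binom_polyS j (x : R) :
  (binom_poly R j.+1).[x] = (binom_poly R j).[x] * ((x - j%:R) / j.+1%:R).
Proof.
rewrite /binom_poly !hornerZ big_ord_recr/= hornerM hornerXsubC factS natrM invfM.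
by ring.
Qed.

Lemma binom_poly0 (x : R) : (binom_poly R 0).[x] = 1.
Proof. by rewrite /binom_poly big_ord0 fact0 invr1 scale1r hornerC. Qed.

Lemma horner_binom_poly_nat j n : (binom_poly R j).[n%:R] = 'C(n, j)%:R.
Proof.
elim: j => [|j IH]; first by rewrite binom_poly0 bin0.
rewrite horner_binom_polyS IH; have j0 : j.+1%:R != 0 :> R by rewrite pnatr_eq0.
apply: (mulIf j0); rewrite mulrA divfK// -natrM.
have [jn|nj] := leqP j n; last by rewrite !bin_small ?mul0r ?mul0n// ltnW.
by rewrite -natrB// -natrM mulnC -mul_bin_left mulnC.
Qed.

Lemma horner_binom_polyN1 j : (binom_poly R j).[-1] = (-1) ^+ j.
Proof.
elim: j => [|j IH]; first by rewrite binom_poly0.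
by rewrite horner_binom_polyS IH -opprD nat1r mulNr divff ?pnatr_eq0// exprSr.
Qed.

Lemma bin_le_exp2 n j : ('C(n, j) <= 2 ^ n)%N.
Proof.
elim: n j => [|n IH] [|j]; rewrite ?bin0 ?expn_gt0//.
by rewrite binS expnS mul2n -addnn leq_add.
Qed.

End binomial_polynomials.

(** * From a nonnegative functional to nonnegative values *)

Section positivity_on_naturals.
Variables (R : realType) (a : R).
Hypothesis a_gt0 : 0 < a.

(* Up to sign, the Lagrange polynomial that is 1 at m and vanishes at the other
   integers of [0, N]. In this form it is visibly at most 4 ^ x at every x,
   uniformly in N. *)
Definition bump_poly m N : {poly R} :=
  binom_poly R m * (binom_poly R (N - m) \Po ('X - m.+1%:R%:P)).

(** At [m] the second factor is [binom(-1, N - m)], a sign. *)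
Lemma bump_polyE m N : (bump_poly m N).[m%:R] ^+ 2 = 1.
Proof.
rewrite hornerM horner_binom_poly_nat binn mul1r horner_comp hornerXsubC.
by rewrite -natr1 opprD addrA subrr sub0r horner_binom_polyN1 sqrr_sign.
Qed.

Lemma bump_poly_gt m N x : (m < x)%N ->
  (bump_poly m N).[x%:R] = ('C(x, m) * 'C(x - m.+1, N - m))%:R.
Proof.
move=> mx; rewrite hornerM horner_binom_poly_nat horner_comp hornerXsubC -natrB//.
by rewrite horner_binom_poly_nat natrM.
Qed.

Lemma bump_poly_eq0 m N x : (m <= N)%N -> (x <= N)%N -> x != m ->
  (bump_poly m N).[x%:R] = 0.
Proof.
move=> mN xN; rewrite neq_ltn => /orP[xm|mx].
  by rewrite hornerM horner_binom_poly_nat bin_small// mul0r.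
by rewrite bump_poly_gt// [X in (_ * X)%N]bin_small ?muln0//; lia.
Qed.

Lemma bump_poly_le m N x : (m < x)%N ->
  (bump_poly m N).[x%:R] ^+ 2 <= 16 ^+ x.
Proof.
move=> mx; rewrite bump_poly_gt// -natrX -natrX ler_nat.
rewrite (_ : 16 = (2 * 2) ^ 2)%N// -expnAC leq_exp2r// expnMn leq_mul ?bin_le_exp2//.
by rewrite (leq_trans (bin_le_exp2 _ _))// leq_exp2l// leq_subr.
Qed.

(* The tail beyond N is controlled, uniformly in the test polynomial, by the
   Poisson series of M^2 + 1 with parameter 16 a. *)
Lemma poisson_pos_nat (M : {poly R}) : (forall p, 0 <= poisson R a (p * p * M)) ->
  forall n : nat, 0 <= M.[n%:R].
Proof.
move=> LM m; rewrite leNgt; apply/negP => Mm.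
pose w := exp_coeff a.
have w_gt0 x : 0 < w x by rewrite divr_gt0 ?exprn_gt0// ltr0n fact_gt0.
pose t := - (M.[m%:R] * w m).
have t_gt0 : 0 < t by rewrite oppr_gt0 pmulr_llt0.
(* [M * M + 1] dominates [|M|], and the parameter [16 * a] absorbs the bound [16 ^ x] on the squared
   test polynomial. *)
pose g := poisson_term R (16 * a) (M * M + 1).
have cg : cvgn (series g) by exact: is_cvg_poisson.
have [N mN lN] : exists2 N, (m <= N)%N & limn (series g) - series g N.+1 < t.
  have /cvgrPdist_lt/(_ _ t_gt0)[N _ HN] := cg.
  exists (maxn m N); first exact: leq_maxl.
  apply: le_lt_trans (HN (maxn m N).+1 _); first exact: ler_norm.
  by rewrite /= leqW// leq_maxr.
pose q := bump_poly m N; pose h := poisson_term R a (q * q * M).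
have hN : series h N.+1 = - t.
  rewrite /series/= big_mkord (bigD1 (Ordinal (mN : (m < N.+1)%N)))//= big1 ?addr0.
    by rewrite /h /poisson_term 2!hornerM -expr2 bump_polyE mul1r opprK.
  move=> i im; rewrite /h /poisson_term 2!hornerM bump_poly_eq0 ?mul0r//.
  by rewrite -ltnS.
have hg x : (N < x)%N -> h x <= g x.
  move=> Nx; have -> : h x = q.[x%:R] ^+ 2 * M.[x%:R] * w x.
    by rewrite /h /poisson_term 2!hornerM -expr2.
  have -> : g x = (M.[x%:R] * M.[x%:R] + 1) * 16 ^+ x * w x.
    rewrite /g /poisson_term hornerD hornerM hornerC -mulrA; congr (_ * _).
    by rewrite /w /exp_coeff/= exprMn mulrA.
  rewrite ler_pM2r ?w_gt0//.
  rewrite mulrC (@le_trans _ _ (`|M.[x%:R]| * 16 ^+ x))//.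
    apply: le_trans (ler_wpM2r (sqr_ge0 _) (ler_norm _)) _.
    by rewrite ler_wpM2l// bump_poly_le// (leq_ltn_trans mN).
  rewrite ler_wpM2r ?exprn_ge0// -expr2 -real_normK ?num_real//.
  (* [(|y| - 1/2) ^ 2 >= 0] gives [|y| <= y ^ 2 + 1]. *)
  by have := sqr_ge0 (`|M.[x%:R]| - 2^-1); nra.
(* The terms up to [N] sum to [- t] and the tail is dominated by that of [g], which is below [t];
   the total is negative, against [LM]. *)
have : limn (series h) <= - t + (limn (series g) - series g N.+1).
  have e : (- t + (series g n - series g N.+1)) @[n --> \oo] -->
      - t + (limn (series g) - series g N.+1).
    by apply: cvgD; [exact: cvg_cst|apply: cvgB => //; exact: cvg_cst].
  rewrite -(cvg_lim _ e)//; apply: ler_lim; [exact: is_cvg_poisson|exact: cvgP e|].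
  near=> n; have Nn : (N.+1 <= n)%N by near: n; exact: nbhs_infty_ge.
  rewrite -hN -lerBlDl !sub_series_geq// !big_nat; apply: ler_sum => x /andP[Nx _].
  exact: hg.
by have := LM q; rewrite -/(poisson _ _ _) /poisson -/h; lra.
Unshelve. all: by end_near. Qed.

End positivity_on_naturals.

(** * Duality between degree and argument *)

Section charlier_at_naturals.
Variables (R : realType) (a : R).
Hypothesis a_neq0 : a != 0.

Definition charlier_sum k n : R :=
  \sum_(j < k.+1) (- a) ^+ (k - j) / (k - j)`!%:R * 'C(n, j)%:R.

Lemma horner_charlier_nat k n : (charlier a k).[n%:R] = charlier_sum k n.
Proof.
rewrite hornerZ horner_sum big_distrr/=; apply: eq_bigr => j _.
rewrite hornerZ horner_binom_poly_nat.
have jk : (j <= k)%N by rewrite -ltnS.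
rewrite -(bin_fact jk) !natrM.
have f0 (i : nat) : i`!%:R != 0 :> R by rewrite pnatr_eq0 -lt0n fact_gt0.
have b0 : 'C(k, j)%:R != 0 :> R by rewrite pnatr_eq0 -lt0n bin_gt0.
by field; rewrite !f0 b0.
Qed.

(** Pascal's rule; up to normalization this is the recursion defining [charlier_op]. *)
Lemma charlier_sumSS k n :
  charlier_sum k.+1 n.+1 = charlier_sum k.+1 n + charlier_sum k n.
Proof.
rewrite /charlier_sum big_ord_recl [in RHS]big_ord_recl/= !bin0 -addrA; congr (_ + _).
rewrite -big_split/=; apply: eq_bigr => j _.
by rewrite /bump/= !add1n subSS binS natrD mulrDr.
Qed.

(* Charlier polynomials are self-dual up to normalization. *)
Lemma charlier_sumE k n :
  charlier_sum k n = (- a) ^+ k / k`!%:R * (charlier_op R a n).[k%:R].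
Proof.
elim: n k => [k|n IH [|k]].
- rewrite hornerC mulr1 /charlier_sum big_ord_recl/= subn0 mulr1 big1 ?addr0// => j _.
  by rewrite mulr0.
- rewrite /= hornerD hornerN hornerZ hornerMX mulr0 mulr0 subr0 -IH.
  by rewrite /charlier_sum !big_ord1 !bin0.
- rewrite charlier_sumSS !IH /= hornerD hornerN hornerZ hornerMX horner_comp hornerD.
  rewrite hornerX hornerN hornerC -[in LHS]natr1 -[in RHS]natr1 addrK.
  rewrite factS natrM -natr1 exprS.
  have k0 : k%:R + 1 != 0 :> R by rewrite natr1 pnatr_eq0.
  by field; rewrite k0 a_neq0 pnatr_eq0 -lt0n fact_gt0.
Qed.

(** Duality turns the shift of the argument into a shift of the degree; the remaining factor depends
    on the row alone and comes out as a diagonal determinant. *)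
Lemma OmegaE (F : {fset nat}) n : Omega a F n%:R =
  \prod_(i < #|` F|) ((- a) ^+ nth 0%N (elems F) i / (nth 0%N (elems F) i)`!%:R) *
  casorati R a [seq f%:R | f <- elems F] n.
Proof.
have sF : size [seq f%:R : R | f <- elems F] = #|` F|.
  by rewrite size_map size_sort.
rewrite /casorati /casorati_mx sF.
pose c : 'rV_ #|` F| := \row_i
  ((- a) ^+ nth 0%N (elems F) i / (nth 0%N (elems F) i)`!%:R).
rewrite [X in _ = X * _](_ : _ = \det (diag_mx c)); last first.
  by rewrite det_diag; apply: eq_bigr => i _; rewrite mxE.
rewrite -det_mulmx; congr (\det _); apply/matrixP => i j.
rewrite mul_diag_mx !mxE -natrD horner_charlier_nat charlier_sumE.
by rewrite (nth_map 0%N)// size_sort.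
Qed.

End charlier_at_naturals.

(** * Admissibility as a sign condition *)

Section sign_of_nodal.
Variable R : realType.
Local Open Scope fset_scope.

Lemma mem_le_sum (F : {fset nat}) f : f \in F -> (f <= \sum_(g <- F) g)%N.
Proof. by move=> fF; rewrite (big_fsetD1 f)//= leq_addr. Qed.

(** Unless a factor vanishes, each [f] above [n] contributes one sign change. *)
Lemma prod_subr_ge0 (s : seq nat) n :
  (0 <= \prod_(f <- s) (n%:R - f%:R) :> R) = (n \in s) || ~~ odd (count (ltn n) s).
Proof.
have [ns|ns] /= := boolP (n \in s).
  by rewrite (big_rem n)//= subrr mul0r lexx.
suff [c c_gt0 ->] : exists2 c : R, 0 < c &
    \prod_(f <- s) (n%:R - f%:R) = (-1) ^+ count (ltn n) s * c.
  rewrite pmulr_lge0// -signr_odd; case: odd; last by rewrite expr0 ler01.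
  by rewrite expr1 ler0N1.
elim: s ns => [_|f s IH]; first by exists 1; rewrite ?ltr01// big_nil mulr1.
rewrite inE negb_or big_cons => /andP[nf /IH[c c_gt0 ->]] /=.
have [lt_nf|lt_fn|e] := ltngtP n f; last by rewrite e eqxx in nf.
  exists ((f%:R - n%:R) * c); first by rewrite mulr_gt0// subr_gt0 ltr_nat.
  by rewrite add1n exprS; ring.
exists ((n%:R - f%:R) * c); first by rewrite mulr_gt0// subr_gt0 ltr_nat.
by rewrite add0n; ring.
Qed.

Lemma elems_sorted (F : {fset nat}) : sorted ltn (elems F).
Proof. by rewrite ltn_sorted_uniq_leq sort_uniq fset_uniq (sort_sorted leq_total). Qed.

Lemma mem_elems (F : {fset nat}) f : (f \in elems F) = (f \in F).
Proof. by rewrite mem_sort. Qed.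

Lemma elems_eq (F : {fset nat}) s : sorted ltn s -> s =i F -> elems F = s.
Proof.
move=> ss sF; apply: (irr_sorted_eq ltn_trans ltnn) => //; first exact: elems_sorted.
by move=> f; rewrite mem_elems sF.
Qed.

Lemma fmin_mem (F : {fset nat}) : F != fset0 -> fmin F \in F.
Proof.
rewrite -mem_elems /fmin -cardfs_gt0 -(size_sort leq) -/(elems F).
by case: (elems F) => //= x s; rewrite mem_head.
Qed.

Lemma fmin_le (F : {fset nat}) f : f \in F -> (fmin F <= f)%N.
Proof.
rewrite -mem_elems /fmin; have := elems_sorted F.
case: (elems F) => //= x s /(order_path_min ltn_trans)/allP xs.
by rewrite inE => /predU1P[->//|/xs/ltnW].
Qed.

(** A natural outside a run of consecutive integers has the whole run above it or none of it. *)
Lemma consecutive_count (Y : {fset nat}) n : consecutive Y -> n \notin Y ->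
  ~~ odd #|` Y| -> ~~ odd (count (ltn n) Y).
Proof.
move=> [_ YE]; rewrite -mem_elems YE mem_iota => nY oY.
have /permP <- : perm_eq (elems Y) Y by rewrite perm_sort.
rewrite YE; set m := fmin Y in nY *; set l := #|` Y| in nY oY *.
have [nm|mn] := ltnP n m.
  rewrite (_ : count _ _ = l)//; apply/eqP.
  rewrite -[X in _ == X](size_iota m l) -all_count.
  by apply/allP => x; rewrite mem_iota => /andP[mx _]; exact: leq_trans mx.
rewrite (_ : count _ _ = 0%N)//; apply/eqP; rewrite -leqn0 leqNgt -has_count.
apply/hasPn => x; rewrite mem_iota -leqNgt => /andP[_ xl].
by move: nY; rewrite mn/= -leqNgt; apply: leq_trans; exact: ltnW.
Qed.

(** A block-free form of admissibility that matches the sign rule for the product. *)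
Definition even_above (F : {fset nat}) : Prop :=
  forall n : nat, n \notin F -> ~~ odd (count (ltn n) F).

Lemma perm_fsetU (A B : {fset nat}) : [disjoint A & B] -> perm_eq (A `|` B) (A ++ B).
Proof.
move=> dAB; apply: uniq_perm; first exact: fset_uniq; last first.
  by move=> x; rewrite mem_cat inE.
rewrite cat_uniq !fset_uniq/= andbT; apply/hasPn => x xB.
by move: dAB; rewrite fdisjoint_sym => /fdisjointP/(_ x xB).
Qed.

Lemma even_above_admissible (F : {fset nat}) : admissible F -> even_above F.
Proof.
move=> [Ys [-> dYs cYs _] eYs] n; elim: Ys dYs cYs eYs => [|Y Ys IH] /=.
  by rewrite big_nil.
rewrite big_cons => /andP[/allP dY dYs] cYs eYs.
rewrite inE negb_or => /andP[nY nYs].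
have dU : [disjoint Y & \bigcup_(Z <- Ys) Z].
  apply/fdisjointP => f fY; apply/negP => /bigfcupP[Z /andP[ZYs _]].
  by apply/negP; move/fdisjointP : (dY _ ZYs) => /(_ f fY).
have /permP -> := perm_fsetU _ _ dU; rewrite count_cat oddD negb_add.
have sub (T : {fset nat} -> Prop) :
  {in Y :: Ys, forall Z, T Z} -> T Y /\ {in Ys, forall Z, T Z}.
  by move=> TYs; split=> [|Z ZYs]; apply: TYs; rewrite inE ?eqxx// ZYs orbT.
have [cY cYs'] := sub _ cYs; have [eY eYs'] := sub (fun Z => is_true (~~ odd _)) eYs.
by rewrite (negPf (consecutive_count Y n cY nY eY)) eq_sym eqbF_neg; exact: IH.
Qed.

(** Induction on the cardinality, splitting off the lowest block. *)
Lemma admissible_even_above (F : {fset nat}) :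
  (forall f, f \in F -> (0 < f)%N) -> even_above F -> admissible F.
Proof.
have [l] := ubnP #|` F|; elim: l F => // l IH F Fl F_gt0 eF.
have [->|F0] := eqVneq F fset0.
  by exists [::] => //; split => //; rewrite big_nil.
pose m := fmin F; have mF : m \in F := fmin_mem F F0.
(* [e] is the first gap above the minimum [m]; it exists because the sum of [F] bounds its
   elements. *)
have [e /andP[me eNF] e_min] : exists2 e, (m <= e)%N && (e \notin F) &
    forall i, (m <= i < e)%N -> i \in F.
  have ex : exists e, (m <= e)%N && (e \notin F).
    exists (\sum_(f <- F) f).+1; rewrite leqW ?mem_le_sum//=.
    by apply/negP => /mem_le_sum; rewrite ltnn.
  exists (ex_minn ex); first by case: ex_minnP.
  case: ex_minnP => e _ e_min i /andP[mi ie]; apply: contraTT ie => iF.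
  by rewrite -leqNgt e_min// mi.
have lt_me : (m < e)%N.
  by rewrite ltn_neqAle me andbT; apply: contraNneq eNF => <-.
pose Y := [fset f in F | (f < e)%N]; pose F' := [fset f in F | (e < f)%N].
have Fm f : f \in F -> (m <= f)%N by exact: fmin_le.
have inY f : (f \in Y) = (m <= f < e)%N.
  rewrite !inE/=; apply/andP/andP => -[].
    by move=> /Fm.
  by move=> mf fe; rewrite e_min// mf.
have inF' f : (f \in F') = (f \in F) && (e < f)%N by rewrite !inE.
have dYF' : [disjoint Y & F'].
  apply/fdisjointP => f; rewrite inY inF' => /andP[_ /ltnW].
  by rewrite leqNgt => /negPf->; rewrite andbF.
have FE : F = Y `|` F'.
  apply/fsetP => f; rewrite in_fsetU !inE/= -andb_orr.
  case fF: (f \in F) => //=; rewrite -neq_ltn; apply/esym.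
  by apply: contraNneq eNF => <-.
have elemsY : elems Y = iota m (e - m).
  apply: elems_eq; first exact: iota_ltn_sorted.
  by move=> f; rewrite inY mem_iota subnKC.
have cardY : #|` Y| = (e - m)%N by rewrite -(size_sort leq) -/(elems Y) elemsY size_iota.
have fminY : fmin Y = m.
  by rewrite /fmin elemsY; case: (e - m)%N (subn_gt0 m e) => //; rewrite lt_me.
have fmaxY : fmax Y = e.-1.
  by rewrite /fmax elemsY -nth_last size_iota nth_iota; lia.
have cY : consecutive Y.
  split; last by rewrite elemsY fminY cardY.
  by rewrite -cardfs_gt0 cardY subn_gt0.
have countF n : count (ltn n) F = (count (ltn n) Y + count (ltn n) F')%N.
  by rewrite FE; have /permP -> := perm_fsetU _ _ dYF'; rewrite count_cat.
have countF' n : (n <= e)%N -> count (ltn n) F' = #|` F'|.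
  move=> ne; apply/eqP; rewrite -all_count; apply/allP => f.
  by rewrite inF' => /andP[_]; exact: leq_ltn_trans.
have countYe n : (e <= n)%N -> count (ltn n) Y = 0%N.
  move=> en; apply/eqP; rewrite -leqn0 leqNgt -has_count; apply/hasPn => f.
  by rewrite inY -leqNgt => /andP[_ /ltnW fe]; exact: leq_trans en.
(* At the gap [e], exactly [F'] lies above. *)
have evenF' : ~~ odd #|` F'|.
  by rewrite -(countF' e)// -[count _ _]add0n -(countYe e)// -countF; exact: eF.
(* As [m] is positive, [m.-1] lies outside [F] with all of [F] above it. *)
have evenY : ~~ odd #|` Y|.
  have m_gt0 : (0 < m)%N by exact: F_gt0.
  have m1F : m.-1 \notin F by apply/negP => /Fm; lia.
  have := eF _ m1F; rewrite countF countF'; last by lia.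
  rewrite oddD (negPf evenF') addbF (_ : count _ _ = #|` Y|)//.
  apply/eqP; rewrite -all_count; apply/allP => f; rewrite inY => /andP[mf _].
  by rewrite /=; lia.
have [|f|n nF'|Ys [F'E dYs cYs sYs] eYs] := IH F'.
- rewrite -ltnS (leq_trans _ Fl)// ltnS FE cardfsU (disjoint_fsetI0 dYF') cardfs0 subn0.
  by rewrite -add1n leq_add2r cardY subn_gt0.
- by rewrite inF' => /andP[/F_gt0].
- have [en|ne] := leqP n e; first by rewrite countF'.
  rewrite -[count _ _]add0n -(countYe n (ltnW ne)) -countF; apply: eF.
  by move: nF'; rewrite inF' ne andbT.
have subF' Z : Z \in Ys -> {subset Z <= F'}.
  by move=> ZYs f fZ; rewrite F'E; apply/bigfcupP; exists Z; rewrite ?ZYs.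
exists (Y :: Ys); last by move=> Z; rewrite inE => /predU1P[->//|/eYs].
split => /=.
- by rewrite big_cons -F'E.
- rewrite dYs andbT; apply/allP => Z /subF' ZF'.
  by apply/fdisjointP => f /(fdisjointP dYF'); apply: contra => /ZF'.
- by move=> Z; rewrite inE => /predU1P[->//|/cYs].
(* The block [Y] ends at [e - 1] and the next one starts above [e], which is the strict gap
   required. *)
- case: Ys F'E dYs cYs sYs eYs subF' => //= Z Ys _ _ cYs -> _ subF'; rewrite andbT fmaxY.
  have [Z0 _] : consecutive Z by apply: cYs; rewrite mem_head.
  have := subF' Z (mem_head _ _) _ (fmin_mem Z Z0).
  by rewrite inF' => /andP[_]; lia.
Qed.

Lemma nodal_nat (F : {fset nat}) n :
  (nodal R [seq f%:R | f <- elems F]).[n%:R] = \prod_(f <- F) (n%:R - f%:R).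
Proof.
rewrite /nodal big_map horner_prod.
under eq_bigr do rewrite hornerXsubC.
by apply: perm_big; rewrite perm_sort.
Qed.

Lemma admissibleP (F : {fset nat}) : (forall f, f \in F -> (0 < f)%N) ->
  admissible F <-> forall n : nat, 0 <= \prod_(f <- F) (n%:R - f%:R) :> R.
Proof.
move=> F_gt0; split => [aF n|F_ge0].
  rewrite prod_subr_ge0; case: (boolP (n \in _)) => //=.
  by move=> /even_above_admissible -/(_ aF).
apply: admissible_even_above => // n nF.
by have := F_ge0 n; rewrite prod_subr_ge0 (negPf nF).
Qed.

End sign_of_nodal.

(** * Point masses and positivity of the charge *)

Lemma discrete_set1 d (T : measurableType d) (R : realType) (w : nat -> R)
    (p : nat -> T) m n : injective p -> (m <= n)%N ->
  discrete w p m [set p n] = (w n)%:E.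
Proof.
(* By injectivity only index [n] contributes, so the partial sums are constant past [n]. *)
move=> p_inj mn; apply: lim_near_cst => //; near=> k.
have nk : (n < k)%N by near: k; exact: nbhs_infty_gt.
rewrite (bigD1_seq n)/= ?mem_index_iota ?mn ?iota_uniq//.
rewrite diracE mem_set// mule1 big1 ?adde0// => i ni.
rewrite diracE memNset ?mule0// => /p_inj /eqP.
exact/negP.
Unshelve. all: by end_near. Qed.

Section sign_of_rho.
Variables (R : realType) (a : R) (F : {fset nat}).
Hypothesis a_gt0 : 0 < a.

Lemma rho_massE n : rho_mass a F (n + uF F) =
  \prod_(f <- F) (n%:R - f%:R) * exp_coeff a n.
Proof.
rewrite /rho_mass addnK; congr (_ * _); apply: eq_bigr => f _.
by rewrite natrD; ring.
Qed.

Lemma positive_rhoP : positive_charge (rho a F) <->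
  forall n : nat, 0 <= \prod_(f <- F) (n%:R - f%:R) :> R.
Proof.
have w_gt0 n : 0 < exp_coeff a n by rewrite divr_gt0 ?exprn_gt0// ltr0n fact_gt0.
have rho1 n : rho a F [set (n + uF F)%:R] =
    (\prod_(f <- F) (n%:R - f%:R) * exp_coeff a n)%:E.
  rewrite -rho_massE; apply: (discrete_set1 _ _ _ (rho_mass a F)
    (fun x => x%:R : measurableTypeR R)).
    by move=> i j /eqP; rewrite eqr_nat => /eqP.
  exact: leq_addl.
split => [[rho_ge0 _] n|F_ge0].
  have : (0 <= rho a F [set (n + uF F)%:R])%E := rho_ge0 _.
  by rewrite rho1 lee_fin pmulr_lge0.
split=> [x|].
  apply: nneseries_ge0 => n un _; rewrite -(subnK un) rho_massE.
  by rewrite mule_ge0// lee_fin mulr_ge0// ltW.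
(* [N] exceeds every element of [F], so its mass is positive and the charge is nonzero. *)
pose N := (\sum_(f <- F) f).+1.
exists [set (N + uF F)%:R]; first exact: measurable_set1.
rewrite [X in X <> _]rho1 => -[/eqP]; apply/negP; rewrite mulf_neq0 ?gt_eqF//.
rewrite big_seq prodr_gt0// => f fF; rewrite subr_gt0 ltr_nat ltnS.
exact: mem_le_sum.
Qed.

End sign_of_rho.

(** * The cycle of implications *)

Theorem lemma4p3 (R : realType) (a : R) (F : {fset nat})
    (a_gt0 : 0 < a) (F_gt0 : forall f : nat, f \in F -> (0 < f)%N) :
  [<-> positive_charge (rho a F);
       admissible F;
       forall n : nat, 0 < Omega a F n%:R * Omega a F n.+1%:R].
Proof.
have a_neq0 : a != 0 by rewrite gt_eqF.
pose s := [seq f%:R : R | f <- elems F].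
have uniq_s : uniq s.
  rewrite map_inj_uniq ?sort_uniq ?fset_uniq// => i j /eqP.
  by rewrite eqr_nat => /eqP.
have nodal_ge0 : (forall n : nat, 0 <= (nodal R s).[n%:R]) <->
    forall n : nat, 0 <= \prod_(f <- F) (n%:R - f%:R) :> R.
  by split=> F_ge0 n; have := F_ge0 n; rewrite nodal_nat.
(* The factor between [Omega] and [casorati] is nonzero and independent of [n], so it enters as a
   positive square. *)
have Omega_gt0 n : (0 < Omega a F n%:R * Omega a F n.+1%:R) =
    (0 < casorati R a s n * casorati R a s n.+1).
  rewrite !OmegaE// mulrACA -expr2 pmulr_rgt0// exprn_even_gt0//=.
  apply/prodf_neq0 => i _; by rewrite mulf_neq0// expf_neq0// oppr_eq0.
tfae.
- by move=> /positive_rhoP -/(_ a_gt0) ?; apply/(admissibleP R F F_gt0).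
- move=> /(admissibleP R F F_gt0)/nodal_ge0 F_ge0 n.
  by rewrite Omega_gt0; exact: casorati_gt0.
- move=> Omega_n; apply/positive_rhoP => //; apply/nodal_ge0.
  apply: (poisson_pos_nat R a a_gt0) => p; apply: poisson_nodal_ge0 => // n.
  by rewrite -Omega_gt0.
Qed.
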